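(* Let $V$ be a diffeological vector space whose underlying vector space is $\mathbb{R}^n$ for some $n$. The characteristic subspace of $V$ does not depend on the choice of a pseudo-metric; that is, any two pseudo-metrics on $V$ determine the same characteristic subspace.
   Context: A diffeological space is a set $X$ with a collection of maps (plots) $U\to X$, for $U$ open in $\mathbb{R}^n$, $n\in\mathbb{N}$, such that: constant maps are plots; the composition of a plot with an ordinary smooth map between open sets of Euclidean spaces is a plot; a map that is locally a plot is a plot. A map $f:X\to Y$ is smooth if $f\circ p$ is a plot of $Y$ for every plot $p$ of $X$. A diffeological vector space is a real vector space with a diffeology for which addition and scalar multiplication are smooth (products carry the product diffeology, $\mathbb{R}$ its standard diffeology). The diffeological dual $V^*$ is the vector space of all smooth linear maps $V\to\mathbb{R}$. A diffeological pseudo-metric on a diffeological vector space $V$ of finite dimension $n$ is a smooth symmetric semi-positive definite bilinear form $g:V\times V\to\mathbb{R}$ whose maximal isotropic subspace (the subspace $\{v\in V: g(v,w)=0\ \forall w\in V\}$) has dimension exactly $n-\dim(V^* )$. If the underlying vector space of $V$ is $\mathbb{R}^n$ and $g$ is a pseudo-metric on $V$ given, with respect to the canonical basis of $\mathbb{R}^n$, by the symmetric $n\times n$ matrix $A$, the characteristic subspace of $V$ (with respect to $g$) is the subspace generated by all eigenvectors of $A$ belonging to its positive eigenvalues. *)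

(* Defs.v *)
From HB Require Import structures.
From mathcomp Require Import all_boot all_order all_algebra.
From mathcomp Require Import all_classical all_reals all_analysis.

Set Implicit Arguments.
Unset Strict Implicit.
Unset Printing Implicit Defensive.

Import Order.TTheory GRing.Theory Num.Theory.
Import numFieldNormedType.Exports.

Local Open Scope classical_set_scope.
Local Open Scope ring_scope.

(* Only meaningful for an open set [U]; [f] is a total function of which only
   the values on [U] matter (see [eq_Ck]). *)
Fixpoint Ck (R : realType) (k : nat) (W : normedModType R) (r : nat)
    (U : set 'rV[R]_k) (f : 'rV[R]_k -> W) : Prop :=
  match r with
  | 0%N => forall x, U x -> {for x, continuous f}
  | r'.+1 => (forall x, U x -> differentiable f x) /\
             (forall v, Ck r' U ('D_v f))
  end.

Definition smooth_on (R : realType) (k : nat) (W : normedModType R)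
  (U : set 'rV[R]_k) (f : 'rV[R]_k -> W) : Prop := forall r, Ck r U f.

Section CkTheory.
Variable R : realType.

Lemma near_eq_differentiable (V W : normedModType R) (f g : V -> W) (x : V) :
  (\near x, f x = g x) -> differentiable f x -> differentiable g x.
Proof.
move=> fg df.
have e : g \o shift x = cst (g x) + 'd f x +o_ 0 id.
  apply/eqaddoP => e e0.
  have /eqaddoP/(_ e e0) := diff_locally df.
  have fg0 : \forall y \near 0, f (y + x) = g (y + x).
    by move: fg; rewrite (near_shift 0) /= subr0.
  apply: filterS2 fg0 => y fgy.
  by rewrite !fctE /= fgy (nbhs_singleton fg).
have dc : continuous ('d f x) by exact: diff_continuous.
have E := diff_unique dc e.
by apply/diff_locallyP; rewrite E.
Qed.

Variable k : nat.
Implicit Types (U V : set 'rV[R]_k) (r : nat).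

Lemma eq_Ck (W : normedModType R) r U (f g : 'rV[R]_k -> W) : open U ->
  (forall x, U x -> f x = g x) -> Ck r U f -> Ck r U g.
Proof.
move=> oU; elim: r f g => [|r IH] f g fg /=.
  move=> cf x Ux; have nfg : \near x, f x = g x.
    by move: (open_nbhs_nbhs (conj oU Ux)); apply: filterS.
  rewrite /prop_for /continuous_at -(fg x Ux).
  exact: cvg_trans (near_eq_cvg nfg) (cf x Ux).
have nfg x : U x -> \near x, f x = g x.
  by move=> Ux; move: (open_nbhs_nbhs (conj oU Ux)); apply: filterS.
move=> [df cf]; split => [x Ux|v].
  exact: near_eq_differentiable (nfg x Ux) (df x Ux).
by apply: IH (cf v) => x Ux; apply: near_eq_derive; exact: nfg.
Qed.

Lemma sub_Ck (W : normedModType R) r U V (f : 'rV[R]_k -> W) :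
  U `<=` V -> Ck r V f -> Ck r U f.
Proof.
move=> UV; elim: r f => [|r IH] f /= => [cf x /UV/cf //|[df cf]].
by split => [x /UV/df//|v]; apply: IH.
Qed.

Lemma local_Ck (W : normedModType R) r U (f : 'rV[R]_k -> W) :
  (forall x, U x -> exists V, [/\ V x & Ck r V f]) -> Ck r U f.
Proof.
elim: r f => [|r IH] f /= H; first by move=> x /H[V [Vx]]; apply.
split => [x /H[V [Vx []]]|v]; first by move=> + _; apply.
by apply: IH => x /H[V [Vx [_ /(_ v)]]]; exists V.
Qed.

Lemma CkS (W : normedModType R) r U (f : 'rV[R]_k -> W) :
  Ck r.+1 U f -> Ck r U f.
Proof.
elim: r f => [|r IH] f.
  by move=> [df _] x Ux; apply: differentiable_continuous; exact: df.
by move=> [df cf]; split => // v; apply: IH; exact: cf.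
Qed.

Lemma cst_Ck (W : normedModType R) r U (c : W) : Ck r U (cst c).
Proof.
elim: r c => [|r IH] c /=; first by move=> x _; exact: cst_continuous.
split => [x _|v]; first exact: differentiable_cst.
suff -> : 'D_v (cst c : 'rV[R]_k -> W) = cst 0 by exact: IH.
by apply/funext => x; rewrite derive_cst.
Qed.

Lemma add_Ck (W : normedModType R) r U (f g : 'rV[R]_k -> W) : open U ->
  Ck r U f -> Ck r U g -> Ck r U (f \+ g).
Proof.
move=> oU; elim: r f g => [|r IH] f g /=.
  by move=> cf cg x Ux; apply: continuousD; [exact: cf|exact: cg].
move=> [df cf] [dg cg]; split => [x Ux|v].
  by apply: differentiableD; [exact: df|exact: dg].
apply: (eq_Ck oU) (IH _ _ (cf v) (cg v)) => x Ux /=.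
by rewrite deriveD//; apply: diff_derivable; [exact: df|exact: dg].
Qed.

Lemma mul_Ck r U (f g : 'rV[R]_k -> R) : open U ->
  Ck r U f -> Ck r U g -> Ck r U (f \* g).
Proof.
move=> oU; elim: r f g => [|r IH] f g.
  by move=> cf cg x Ux; apply: continuousM; [exact: cf|exact: cg].
move=> Cf Cg; have [/= df cf] := Cf; have [/= dg cg] := Cg.
split => [x Ux|v].
  by apply: differentiableM; [exact: df|exact: dg].
apply: (eq_Ck oU) (add_Ck oU (IH _ _ (CkS Cf) (cg v)) (IH _ _ (CkS Cg) (cf v))).
by move=> x Ux /=; rewrite deriveM//; apply: diff_derivable; [exact: df|exact: dg].
Qed.

Lemma coord_Ck m r U (g : 'rV[R]_k -> 'rV[R]_m) i : open U ->
  Ck r U g -> Ck r U (fun x => g x 0 i).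
Proof.
move=> oU; elim: r g => [|r IH] g /=.
  move=> cg x Ux.
  apply: (@continuous_comp _ _ _ g (fun y : 'rV[R]_m => y 0 i) x (cg x Ux)).
  exact: coord_continuous.
move=> [dg cg]; split => [x Ux|v].
  apply: (@differentiable_comp _ _ _ _ g (fun y : 'rV[R]_m => y 0 i)).
    exact: dg.
  exact: differentiable_coord.
apply: (eq_Ck oU) (IH _ (cg v)) => x Ux.
by rewrite derive_mx ?mxE//; apply: diff_derivable; exact: dg.
Qed.

End CkTheory.

Lemma sum_Ck (R : realType) k m r (U : set 'rV[R]_k)
    (F : 'I_m -> 'rV[R]_k -> R) : open U ->
  (forall i, Ck r U (F i)) -> Ck r U (fun x => \sum_i F i x).
Proof.
move=> oU; elim: m F => [|m IH] F CF.
  by apply: (eq_Ck oU) (cst_Ck r U (0 : R)) => x _; rewrite big_ord0.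
apply: (eq_Ck oU) (add_Ck oU (CF ord0) (IH _ (fun i => CF (lift ord0 i)))).
by move=> x _ /=; rewrite big_ord_recl.
Qed.

Lemma comp_Ck (R : realType) k m r (U : set 'rV[R]_k) (V : set 'rV[R]_m)
    (f : 'rV[R]_m -> R) (g : 'rV[R]_k -> 'rV[R]_m) :
  open U -> (forall x, U x -> V (g x)) ->
  Ck r V f -> Ck r U g -> Ck r U (f \o g).
Proof.
move=> oU UV; elim: r f => [|r IH] f.
  move=> cf cg x Ux; apply: (@continuous_comp _ _ _ g f x (cg x Ux)).
  by apply: cf; exact: UV.
move=> [/= df cf] Cg; have [/= dg cg] := Cg; split => [x Ux|v].
  by apply: differentiable_comp; [exact: dg|apply: df; exact: UV].
pose F i x := 'D_v g x 0 i * 'D_(delta_mx 0 i) f (g x).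
have : Ck r U (fun x => \sum_i F i x).
  apply: sum_Ck => // i; apply: mul_Ck => //; first exact: coord_Ck.
  exact: IH (cf _) (CkS Cg).
apply: eq_Ck => // x Ux; have dfx := df _ (UV _ Ux); have dgx := dg _ Ux.
rewrite [RHS]deriveE; last exact: differentiable_comp.
rewrite diff_comp// /= -(deriveE _ dgx) [X in 'd f _ X]row_sum_delta.
rewrite linear_sum; apply: eq_bigr => i _.
by rewrite linearZ /F (deriveE _ dgx) (deriveE _ dfx).
Qed.

(* A plot with domain the open set [U] of R^k is represented by a total
   function, considered up to equality on [U] ([plot_eq]). *)
Record diffeology (R : realType) (X : Type) := Diffeology {
  plot : forall k, set 'rV[R]_k -> ('rV[R]_k -> X) -> Prop;
  plot_open : forall k (U : set 'rV[R]_k) p, plot U p -> open U;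
  plot_eq : forall k (U : set 'rV[R]_k) p q,
    (forall x, U x -> p x = q x) -> plot U p -> plot U q;
  plot_cst : forall k (U : set 'rV[R]_k) c, open U -> plot U (fun=> c);
  plot_comp : forall k m (U : set 'rV[R]_k) (V : set 'rV[R]_m) p h,
    plot V p -> open U -> smooth_on U h -> (forall x, U x -> V (h x)) ->
    plot U (p \o h);
  plot_local : forall k (U : set 'rV[R]_k) p, open U ->
    (forall x, U x -> exists V, [/\ V `<=` U, V x & plot V p]) -> plot U p
}.

Section RealDiffeology.
Variable R : realType.

Let rplot k (U : set 'rV[R]_k) (p : 'rV[R]_k -> R) := open U /\ smooth_on U p.

Let rplot_open k (U : set 'rV[R]_k) p : rplot U p -> open U.
Proof. by case. Qed.

Let rplot_eq k (U : set 'rV[R]_k) p q :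
  (forall x, U x -> p x = q x) -> rplot U p -> rplot U q.
Proof. by move=> pq [oU sp]; split => // r; exact: eq_Ck (sp r). Qed.

Let rplot_cst k (U : set 'rV[R]_k) c : open U -> rplot U (fun=> c).
Proof. by move=> oU; split => // r; exact: cst_Ck. Qed.

Let rplot_comp k m (U : set 'rV[R]_k) (V : set 'rV[R]_m) p h :
  rplot V p -> open U -> smooth_on U h -> (forall x, U x -> V (h x)) ->
  rplot U (p \o h).
Proof.
by move=> [oV sp] oU sh UV; split => // r; apply: comp_Ck UV (sp r) (sh r).
Qed.

Let rplot_local k (U : set 'rV[R]_k) p : open U ->
  (forall x, U x -> exists V, [/\ V `<=` U, V x & rplot V p]) -> rplot U p.
Proof.
move=> oU H; split => // r; apply: local_Ck => x /H[V [_ Vx [_ sp]]].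
by exists V; split => //; exact: sp.
Qed.

Definition real_diffeology : diffeology R R :=
  Diffeology rplot_open rplot_eq rplot_cst rplot_comp rplot_local.

End RealDiffeology.

Section ProdDiffeology.
Variables (R : realType) (X Y : Type).
Variables (DX : diffeology R X) (DY : diffeology R Y).

Let pplot k (U : set 'rV[R]_k) (p : 'rV[R]_k -> X * Y) :=
  plot DX U (fst \o p) /\ plot DY U (snd \o p).

Let pplot_open k (U : set 'rV[R]_k) p : pplot U p -> open U.
Proof. by case=> /plot_open. Qed.

Let pplot_eq k (U : set 'rV[R]_k) p q :
  (forall x, U x -> p x = q x) -> pplot U p -> pplot U q.
Proof.
by move=> pq [p1 p2]; split; [apply: plot_eq p1|apply: plot_eq p2];
  move=> x Ux /=; rewrite pq.
Qed.

Let pplot_cst k (U : set 'rV[R]_k) c : open U -> pplot U (fun=> c).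
Proof. by move=> oU; split; exact: plot_cst. Qed.

Let pplot_comp k m (U : set 'rV[R]_k) (V : set 'rV[R]_m) p h :
  pplot V p -> open U -> smooth_on U h -> (forall x, U x -> V (h x)) ->
  pplot U (p \o h).
Proof.
move=> [p1 p2] oU sh UV.
by split; [exact: plot_comp p1 oU sh UV|exact: plot_comp p2 oU sh UV].
Qed.

Let pplot_local k (U : set 'rV[R]_k) p : open U ->
  (forall x, U x -> exists V, [/\ V `<=` U, V x & pplot V p]) -> pplot U p.
Proof.
by move=> oU H; split; apply: plot_local => // x /H[V [VU Vx []]]; exists V.
Qed.

Definition prod_diffeology : diffeology R (X * Y) :=
  Diffeology pplot_open pplot_eq pplot_cst pplot_comp pplot_local.

End ProdDiffeology.

Definition diffeo_smooth (R : realType) (X Y : Type) (DX : diffeology R X)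
    (DY : diffeology R Y) (f : X -> Y) : Prop :=
  forall k (U : set 'rV[R]_k) p, plot DX U p -> plot DY U (f \o p).

Definition is_vector_diffeology (R : realType) (V : lmodType R)
    (D : diffeology R V) : Prop :=
  diffeo_smooth (prod_diffeology D D) D (fun x : V * V => x.1 + x.2) /\
  diffeo_smooth (prod_diffeology (real_diffeology R) D) D
    (fun x : R * V => x.1 *: x.2).

Section SpanSet.
Variables (K : fieldType) (vT : vectType K).
Implicit Types (S : set vT) (W : {vspace vT}).

Definition is_span S W : Prop :=
  (forall v, S v -> v \in W) /\
  (forall W', (forall v, S v -> v \in W') -> (W <= W')%VS).

Definition span_set S : {vspace vT} := xget 0%VS [set W | is_span S W].

Lemma fin_span S : exists X : seq vT,
  (forall v, v \in X -> S v) /\ (forall v, S v -> v \in <<X>>%VS).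
Proof.
pose P d := `[< exists X : seq vT,
  (forall v, v \in X -> S v) /\ \dim <<X>>%VS = d >].
have exP : exists d, P d by exists 0%N; apply/asboolP; exists [::];
  rewrite span_nil dimv0.
have ubP d : P d -> (d <= \dim {:vT})%N.
  by move=> /asboolP[X [_ <-]]; rewrite dimvS// subvf.
case: (ex_maxnP exP ubP) => d /asboolP[X [XS dX]] maxd.
exists X; split => // v Sv.
have le : (<<X>> <= <<v :: X>>)%VS.
  by apply: sub_span => y yX; rewrite inE yX orbT.
have /eqP -> : <<X>>%VS == <<v :: X>>%VS.
  rewrite eqEdim le dX maxd//; apply/asboolP; exists (v :: X); split => //.
  by move=> y; rewrite inE => /orP[/eqP->//|/XS].
by rewrite memv_span// mem_head.
Qed.

Lemma span_setP S : is_span S (span_set S).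
Proof.
rewrite /span_set; case: xgetP => // nex; exfalso.
have [X [XS SX]] := fin_span S.
apply: (nex <<X>>%VS); split => // W' SW'.
by apply/span_subvP => v /XS/SW'.
Qed.

Lemma mem_span_set S v : S 0 -> (forall a x y, S x -> S y -> S (a *: x + y)) ->
  (v \in span_set S) <-> S v.
Proof.
move=> S0 SL; have [sub least] := span_setP S; split; last exact: sub.
have [X [XS SX]] := fin_span S.
move=> /(subvP (least _ SX))/(@coord_span _ _ _ (in_tuple X)) ->.
apply: (big_ind S) => //= [x y Sx Sy|i _].
  by rewrite -[x]scale1r; exact: SL.
by rewrite -[_ *: _]addr0; apply: SL => //; apply: XS; rewrite mem_nth.
Qed.

End SpanSet.

Section PseudoMetric.
Variables (R : realType) (V : vectType R) (D : diffeology R V).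

Definition smooth_linear : set 'Hom(V, R^o) :=
  [set f | diffeo_smooth D (real_diffeology R) (f : V -> R)].

Definition diffeo_dual : {vspace 'Hom(V, R^o)} := span_set smooth_linear.

Lemma mem_diffeo_dual (f : 'Hom(V, R^o)) :
  (f \in diffeo_dual) <-> diffeo_smooth D (real_diffeology R) (f : V -> R).
Proof.
apply: mem_span_set => [k U p /plot_open oU|a g h sg sh k U p Up].
  apply: (@plot_eq _ _ (real_diffeology R) _ _ (fun=> 0)) => [x _ /=|].
    by rewrite lfunE.
  exact: plot_cst.
have [oU Cg] := sg _ _ _ Up; have [_ Ch] := sh _ _ _ Up; split => // r.
apply: (eq_Ck oU) (add_Ck oU (mul_Ck oU (cst_Ck r U (a : R)) (Cg r)) (Ch r)).
by move=> x _ /=; rewrite add_lfunE scale_lfunE.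
Qed.

Definition isotropic (g : {biscalar V}) : {vspace V} :=
  span_set [set v | forall w, g v w = 0].

Lemma mem_isotropic (g : {biscalar V}) v :
  (v \in isotropic g) <-> forall w, g v w = 0.
Proof.
apply: mem_span_set => [w|a x y gx gy w]; first by rewrite linear0l.
by rewrite linearPl gx gy mulr0 addr0.
Qed.

Definition is_pseudo_metric (g : {biscalar V}) : Prop :=
  [/\ diffeo_smooth (prod_diffeology D D) (real_diffeology R)
        (fun x : V * V => g x.1 x.2),
      forall v w, g v w = g w v,
      forall v, 0 <= g v v
    & \dim (isotropic g) = (\dim {:V} - \dim diffeo_dual)%N].

End PseudoMetric.

Section Characteristic.
Variables (R : realType) (n : nat).

Definition gram (g : {biscalar 'rV[R]_n}) : 'M[R]_n :=
  \matrix_(i, j) g (delta_mx 0 i) (delta_mx 0 j).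

(* Vectors of R^n are rows, so eigenvectors are left eigenvectors; for a
   symmetric [g] these are the transposes of the right ones. *)
Definition char_subspace (g : {biscalar 'rV[R]_n}) : {vspace 'rV[R]_n} :=
  span_set [set v | v != 0 /\
    exists2 a : R, 0 < a & (v <= eigenspace (gram g) a)%MS].

End Characteristic.

(* Main.v *)
(* For a pseudo-metric g the map v |-> g v _ takes values in the smooth dual and
   its kernel is the isotropic subspace, so by the dimension condition its
   image is the whole dual. Hence the Gram matrices A1 and A2 of two
   pseudo-metrics have the same row space. As a Gram matrix is symmetric and
   positive semidefinite, the spectral theorem identifies its row space with
   the span of the eigenvectors for positive eigenvalues. *)
From HB Require Import structures.
Require Import Defs.
From mathcomp Require Import all_boot all_order all_algebra.
From mathcomp Require Import complex.
From mathcomp Require Import all_classical all_reals all_analysis.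

Import Order.TTheory GRing.Theory Num.Theory.

Local Open Scope ring_scope.

Lemma mxOver_realP {R : rcfType} {m n : nat} {M : 'M[R[i]]_(m, n)} :
  M \is a mxOver Num.real -> exists N, M = map_mx (real_complex R) N.
Proof.
move=> /mxOverP rM; exists (map_mx (@complex.Re R) M); apply/matrixP => i j.
by rewrite !mxE -[LHS](RRe_real (rM i j)).
Qed.

(* The diagonalization over R[i] has a real spectrum, so [real_similar] makes
   the base change real. *)
Lemma symmetric_mx_diagonalization {R : rcfType} {n : nat} {A : 'M[R]_n} :
  A^T = A ->
  exists2 P : 'M[R]_n, P \in unitmx & exists d, P *m A = diag_mx d *m P.
Proof.
move=> sA; pose AC := map_mx (real_complex R) A.
have rAC : AC \is a mxOver Num.real.
  by apply/mxOverP => i j; rewrite mxE; apply/complex_realP; exists (A i j).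
have hAC : AC \is hermsymmx.
  apply: realsym_hermsym rAC; apply/is_hermitianmxP.
  by rewrite expr0 scale1r map_mx_id // map_trmx sA.
have uPC := spectral_unit AC.
have dPC : similar (spectralmx AC) AC (diag_mx (spectral_diag AC)).
  have /orthomx_spectralP e := hermitian_normalmx hAC.
  by apply/(similarP uPC); rewrite {2}e -[in LHS]mulmxA mulKVmx.
have [d ed] := mxOver_realP (hermitian_spectral_diag_real hAC).
rewrite ed -map_diag_mx in dPC.
have rd : map_mx (real_complex R) (diag_mx d) \is a mxOver Num.real.
  by apply/mxOverP => i j; rewrite mxE; apply/complex_realP; eexists.
have [P] := real_similar (ex_intro2 (fun P => P \in unitmx) _ _ uPC dPC) rAC rd.
rewrite inE => /andP[/mxOver_realP[Q ->] uQ] /(similarP uQ).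
rewrite -!map_mxM => /map_mx_inj QA.
by exists Q; [rewrite map_unitmx in uQ|exists d].
Qed.

Lemma gramE (R : realType) (n : nat) (g : {biscalar 'rV[R]_n})
    (u v : 'rV[R]_n) : g u v = (u *m gram g *m v^T) 0 0.
Proof.
rewrite mxE [in LHS](row_sum_delta v) linear_sumr; apply: eq_bigr => j _.
rewrite linearZr_LR /= [in LHS](row_sum_delta u) linear_sumlz !mxE mulrC.
by congr (_ * _); apply: eq_bigr => i _; rewrite linearZl_LR /= !mxE.
Qed.

Lemma dotmx_gt0 {R : realDomainType} {n : nat} {v : 'rV[R]_n} :
  v != 0 -> 0 < (v *m v^T) 0 0.
Proof.
move=> v0; rewrite mxE lt_neqAle eq_sym psumr_neq0 => [|i _].
  rewrite sumr_ge0 ?andbT => [|i _]; last by rewrite mxE -expr2 sqr_ge0.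
  have /rV0Pn[i vi] := v0; apply/hasP; exists i; first by rewrite mem_index_enum.
  by rewrite mxE -expr2 exprn_even_gt0.
by rewrite mxE -expr2 sqr_ge0.
Qed.

(** The rows of a diagonalizing [P] are eigenvectors: in the expansion of [u] along them, the Gram
    matrix kills those with eigenvalue zero and keeps only multiples of the others, whose
    eigenvalues are positive. *)
Lemma mulmx_gram_char_subspace (R : realType) (n : nat)
    (g : {biscalar 'rV[R]_n}) (u : 'rV[R]_n) :
  (forall v w, g v w = g w v) -> (forall v, 0 <= g v v) ->
  u *m gram g \in char_subspace g.
Proof.
move=> gC g0; have sG : (gram g)^T = gram g.
  by apply/matrixP => i j; rewrite !mxE gC.
have [P uP [d Pd]] := symmetric_mx_diagonalization sG.
(* With [u] written as [u *m invmx P *m P], the product becomes a linear combination of the rows of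
   [P]. *)
rewrite -[u](mulmxKV uP) -(mulmxA _ P) Pd mulmxA mulmx_sum_row.
apply: memv_suml => i _; rewrite mul_mx_diag mxE.
have Pi : row i P *m gram g = d 0 i *: row i P.
  by rewrite -row_mul Pd row_mul row_diag_mx -scalemxAl -rowE.
have [->|Pi0] := eqVneq (row i P) 0; first by rewrite scaler0 mem0v.
have [->|d0] := eqVneq (d 0 i) 0; first by rewrite mulr0 scale0r mem0v.
apply: memvZ; apply: (span_setP _).1; split=> //; exists (d 0 i).
  (* On an eigenvector, [g] equals the eigenvalue times the squared Euclidean norm, so [0 <= g v v]
     fixes the sign. *)
  have := g0 (row i P); rewrite gramE Pi -scalemxAl mxE.
  by rewrite pmulr_lge0 ?dotmx_gt0// le_eqVlt eq_sym (negPf d0).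
exact/eigenspaceP.
Qed.

Section Representation.
Variables (R : realType) (V : vectType R) (D : diffeology R V).
Variable g : {biscalar V}.

Definition biscalar_hom (v : V) : 'Hom(V, R^o) := linfun (g v : V -> R^o).

Lemma biscalar_homE v w : biscalar_hom v w = g v w.
Proof. by rewrite lfunE. Qed.

Lemma biscalar_hom_is_linear : linear biscalar_hom.
Proof.
move=> a u v; apply/lfunP => w.
by rewrite add_lfunE scale_lfunE !biscalar_homE linearPl.
Qed.

HB.instance Definition _ :=
  GRing.isLinear.Build R V 'Hom(V, R^o) _ biscalar_hom biscalar_hom_is_linear.

Lemma biscalar_hom_smooth v :
  diffeo_smooth (prod_diffeology D D) (real_diffeology R)
    (fun x : V * V => g x.1 x.2) ->
  diffeo_smooth D (real_diffeology R) (biscalar_hom v : V -> R).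
Proof.
move=> sg k U p Up.
(* Pairing a plot with the constant plot at [v] gives a plot of the product. *)
apply: plot_eq (sg k U (fun x => (v, p x)) _) => [x _ /=|].
  by rewrite biscalar_homE.
by split => //; apply: plot_cst; exact: plot_open Up.
Qed.

(** A Riesz-type representation, obtained from rank-nullity for [biscalar_hom]. *)
Lemma pseudo_metric_representation (f : 'Hom(V, R^o)) :
  is_pseudo_metric D g -> f \in diffeo_dual D ->
  exists v, forall w, f w = g v w.
Proof.
move=> [sg _ _ dimI] fD; pose T := linfun biscalar_hom.
have TD : (limg T <= diffeo_dual D)%VS.
  apply/subvP => _ /memv_imgP[v _ ->]; rewrite lfunE /=.
  by apply/mem_diffeo_dual; exact: biscalar_hom_smooth.
have kerT : lker T = isotropic g.
  apply/vspaceP => v; apply/idP/idP; rewrite memv_ker lfunE /=.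
    move=> /eqP Tv; apply/mem_isotropic => w.
    by rewrite -biscalar_homE Tv lfunE.
  move=> /mem_isotropic gv; apply/eqP/lfunP => w.
  by rewrite biscalar_homE gv lfunE.
(* The codimension in [is_pseudo_metric] is a truncated subtraction; this bound makes it exact. *)
have dual_le : (\dim (diffeo_dual D) <= \dim {:V})%N.
  by apply: leq_trans (dimvS (subvf _)) _; rewrite !dimvf /dim /= muln1.
have : limg T == diffeo_dual D.
  rewrite eqEdim TD /= -(leq_add2l (\dim (lker T))) -[lker T]capfv.
  by rewrite limg_ker_dim capfv kerT dimI subnK.
move=> /eqP imT; move: fD; rewrite -imT => /memv_imgP[v _ ->].
by exists v => w; rewrite lfunE /= biscalar_homE.
Qed.

End Representation.

(** An eigenvector with eigenvalue [a > 0] is [a^-1] times its image under the first Gram matrix,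
    and that image lies in the row space of the second. *)
Lemma char_subspace_sub (R : realType) (n : nat) (D : diffeology R 'rV[R]_n)
    (g1 g2 : {biscalar 'rV[R]_n}) :
  is_pseudo_metric D g1 -> is_pseudo_metric D g2 ->
  (char_subspace g1 <= char_subspace g2)%VS.
Proof.
move=> pg1 pg2; have [sg1 _ _ _] := pg1; have [_ gC g0 _] := pg2.
apply: (span_setP _).2 => v [_ [a a0 /eigenspaceP va]].
have /mem_diffeo_dual := biscalar_hom_smooth _ _ _ _ v sg1.
move=> /(pseudo_metric_representation _ _ _ _ _ pg2)[u g12].
(* Evaluating [g1 v] and [g2 u] on the canonical basis compares the two rows entrywise. *)
have e : v *m gram g1 = u *m gram g2.
  apply/rowP => j; have := g12 (delta_mx 0 j).
  by rewrite biscalar_homE !gramE trmx_delta -!colE !mxE.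
rewrite -[v](scalerK (lt0r_neq0 a0)) -va e.
by apply: memvZ; exact: mulmx_gram_char_subspace.
Qed.

Theorem theorem2p11 (R : realType) (n : nat) (D : diffeology R 'rV[R]_n)
    (HD : is_vector_diffeology D) (g1 g2 : {biscalar 'rV[R]_n})
    (Hg1 : is_pseudo_metric D g1) (Hg2 : is_pseudo_metric D g2) :
  char_subspace g1 = char_subspace g2.
Proof.
by apply: subv_anti; rewrite !(char_subspace_sub _ _ D).
Qed.
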